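(* There is an absolute constant $C>0$ (independent of $p$ and $K$) such that the following holds. Let $p$ be a prime, let $K\in\mathbb{F}_p^*$, and let $\mathcal{F}_p=\{F_n \mid n\ge 0\}\subseteq\mathbb{F}_p$ be the set of elements of the $K$-Fibonacci sequence modulo $p$, defined by $F_0=0$, $F_1=1$, $F_{n+2}=K F_{n+1}+F_n$ for $n\ge 0$. If $|\mathcal{F}_p|<\frac16 p^{3/4}$, then $$|\mathcal{F}_p+\mathcal{F}_p|>C\,|\mathcal{F}_p|^{4/3}\qquad\text{and}\qquad |\mathcal{F}_p\cdot\mathcal{F}_p|>C\,|\mathcal{F}_p|^{4/3}.$$
   Context: For a finite set $A\subseteq\mathbb{F}_p$, $A+A=\{a+b\mid a,b\in A\}$ and $A\cdot A=\{ab\mid a,b\in A\}$; $|A|$ denotes cardinality. *)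

(* Defs.v *)
From HB Require Import structures.
From mathcomp Require Import all_boot all_order all_algebra.
From mathcomp Require Import boolp reals exp.

Set Implicit Arguments.
Unset Strict Implicit.
Unset Printing Implicit Defensive.

Import Order.TTheory GRing.Theory Num.Theory.
Local Open Scope ring_scope.

Fixpoint kfib (R : pzRingType) (K : R) (n : nat) : R :=
  match n with
  | 0%N => 0
  | n1.+1 =>
      match n1 with
      | 0%N => 1
      | n2.+1 => K * kfib K n1 + kfib K n2
      end
  end.

(* Membership quantifies over all n : nat, so it is made boolean by asbool. *)
Definition kfib_set (p : nat) (K : 'F_p) : {set 'F_p} :=
  [set x : 'F_p | `[< exists n : nat, x = kfib K n >]].

Definition sumset (p : nat) (A : {set 'F_p}) : {set 'F_p} :=
  [set a + b | a in A, b in A].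

Definition prodset (p : nat) (A : {set 'F_p}) : {set 'F_p} :=
  [set a * b | a in A, b in A].

(* Main.v *)
Require Import Defs.
From HB Require Import structures.
From mathcomp Require Import all_boot all_order all_algebra all_field.
From mathcomp Require Import boolp reals exp.
From mathcomp Require Import ring lra zify.

Set Implicit Arguments.
Unset Strict Implicit.
Unset Printing Implicit Defensive.

Import Order.TTheory GRing.Theory Num.Theory.
Local Open Scope ring_scope.

(** Let a, b be the roots of X^2 - K X - 1 in an extension L of F_p, so that
    a b = -1, and let t be the order of g = a^2.  By Binet's formula
    (a - b) F_(2n) = g^n - g^(-n), and F_n only depends on n modulo 2t; hence
    the number of terms of the sequence lies between t / 2 and 2t.  (When a = b
    the sequence takes all values modulo p, which its size forbids.)

    It suffices to show that a nonzero c is represented O(t^(2/3)) times as a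
    product F_(2i) F_(2j), or as a sum F_(4i) + F_(4j): since zero has O(t)
    representations among the t^2 pairs, the product set and the sum set then
    have at least of the order of t^2 / t^(2/3) = t^(4/3) elements.  With
    u = g^i, v = g^j in the first case, and u = g^(i+j), v = g^(i-j) in the
    second one, a representation is, after rescaling c, a point of the curve

         (u - 1/u) (v - eps/v) = c,      eps = 1, resp. eps = -1,

    whose coordinates satisfy u^T = v^T = 1, where T = 2t.  So everything rests
    on [curve_subgroup_bound]: only O(T^(2/3)) values of u occur.

    That bound is proved by Stepanov's method, carried out with polynomials in
    the single variable u.  Write E = u^2 - 1.  For given u the two solutions
    v, v' = -eps/v of the curve equation are such that the power sum
    N = E^T (v^T + v'^T) is a polynomial in u of degree at most 2T, and at the
    points to be counted u^T = 1 and N = 2 E^T.  Consider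

         Psi = sum over i < A, k < B, l < B of
                 a_(i,k,l) u^(i+Tk) E^(T(B-1-l)) N^l.

    - The derivation w d/du, for a suitable polynomial w, maps the span of N and
      its companion M = E^(T-1) (v^T - v'^T) / (v - v') into itself, with
      coefficients of degree at most 7 ([wderiv_N], [wderiv_M]).  Since M
      vanishes at the points to be counted, the j-th derivative of each term of
      Psi is there a common factor times a polynomial of degree less than
      A + 7j ([iter_wderiv_at_point]).  Vanishing of Psi to order m at all the
      points thus follows from m (A + 7m) linear conditions, and there is a
      nonzero solution as soon as m (A + 7m) < A B^2.
    - Psi is then not the zero polynomial ([auxpol_free]).  Otherwise E^T would
      divide the coefficient of the highest power of N that occurs; that
      coefficient has at most A B <= T terms and degree less than p, while in
      characteristic p such a polynomial has order less than A B at 1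
      ([lacunary_dvdp_eq0]).
    - Comparing with the degree of Psi, the number of points times m is less
      than A + 3T(B-1) ([stepanov_bound]).

    For A = n^2, B = n, m = n^2/8 with n the integral part of the cube root of
    T, this gives O(n^2) points.  The hypothesis on the size of the sequence is
    what makes the degree bound A + T(B-1) <= p, roughly T^(4/3) <= p, hold. *)

(** * Order of vanishing and derivations *)

Lemma natr_neq0_ltp (L : fieldType) (p r : nat) :
  p \in [pchar L] -> (0 < r < p)%N -> r%:R != 0 :> L.
Proof.
move=> pL /andP[r0 rp]; rewrite -(dvdn_pcharf pL); apply/negP => /dvdn_leq.
by move=> /(_ r0); rewrite leqNgt rp.
Qed.

Definition wderiv (L : fieldType) (w f : {poly L}) : {poly L} := w * f^`().

(** At x the derivation lowers a nonzero order of vanishing by exactly one,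
    unless that order is a multiple of p; hence the restriction m <= p. *)
Lemma dvdp_exp_wderiv (L : fieldType) (p : nat) (w f : {poly L}) (x : L) (m : nat) :
  p \in [pchar L] -> w.[x] != 0 -> (m <= p)%N ->
  (forall j, (j < m)%N -> (iter j (wderiv w) f).[x] = 0) ->
  ('X - x%:P) ^+ m %| f.
Proof.
move=> pL wx; elim: m f => [|m IHm] f lemp fj; first by rewrite expr0 dvd1p.
have [m0|m_gt0] := posnP m.
  by rewrite m0 expr1 dvdp_XsubCl; apply/eqP; apply: (fj 0%N).
have /(IHm _ (ltnW lemp)) : forall j, (j < m)%N ->
    (iter j (wderiv w) (wderiv w f)).[x] = 0.
  by move=> j jm; rewrite -iterSr; apply: fj.
rewrite Gauss_dvdpr; last first.
  by rewrite coprimep_expl // coprimep_sym coprimep_XsubC rootE.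
(* With f = q (X - x)^m, the divisibility of f' by (X - x)^m forces that of
   m q by X - x, and m is invertible. *)
have /dvdpP[q ->] : ('X - x%:P) ^+ m %| f.
  by apply: IHm => [|j jm]; [exact: ltnW | apply: fj; exact: ltnW].
rewrite derivM (dvdp_addr _ (dvdp_mull _ (dvdpp _))).
case: m m_gt0 lemp {IHm fj} => // m _ lemp.
rewrite deriv_exp derivXsubC mul1r /= -mulr_natl -polyC_natr mul_polyC.
rewrite -scalerAr dvdpZr ?(natr_neq0_ltp pL) //.
have nzX k : ('X - x%:P) ^+ k != 0 :> {poly L}.
  by rewrite expf_neq0 // polyXsubC_eq0.
by rewrite exprS dvdp_mul2r // => xq; rewrite -exprS exprS dvdp_mul2r.
Qed.

Lemma size_dvdp_prod_XsubC (L : fieldType) (f : {poly L}) (s : seq L) (m : nat) :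
  uniq s -> f != 0 -> (forall x, x \in s -> ('X - x%:P) ^+ m %| f) ->
  (size s * m < size f)%N.
Proof.
move=> us nf sf.
have : \prod_(x <- s) ('X - x%:P) ^+ m %| f.
  elim: s us sf => [|x s IHs] /=; first by rewrite big_nil dvd1p.
  case/andP=> xs us sf; rewrite big_cons Gauss_dvdp ?sf ?mem_head //=.
    by apply: IHs => // y ys; apply: sf; rewrite in_cons ys orbT.
  rewrite prodrXl coprimep_expl // coprimep_expr // coprimep_sym.
  by rewrite coprimep_XsubC root_prod_XsubC.
move/dvdp_leq => /(_ nf); apply: leq_trans.
rewrite prodrXl -[X in (_ < X)%N]prednK ?size_exp ?size_prod_XsubC ?ltnS //.
by rewrite size_poly_gt0 expf_neq0 // monic_neq0 // monic_prod_XsubC.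
Qed.

(** * Lacunary polynomials at 1 *)

(** A polynomial of degree less than p with k terms cannot vanish to order k
    at 1: each application of X d/dX - e kills one term and costs one order. *)
Lemma lacunary_dvdp_eq0 (L : fieldType) (p : nat) (s : seq nat) (f : {poly L}) :
  p \in [pchar L] -> all (fun i => i < p)%N s ->
  (size f <= p)%N ->
  (forall i, i \notin s -> f`_i = 0) -> ('X - 1) ^+ size s %| f -> f = 0.
Proof.
move=> pL; elim: s f => [|e s IHs] f /= => [_ _ f0 _ | /andP[ep sp] sf f0 Xf].
  by apply/polyP=> i; rewrite f0 ?coef0.
pose g := 'X * f^`() - e%:R *: f.
have gE i : g`_i = (i%:R - e%:R) * f`_i.
  rewrite coefB coefZ coefXM mulrBl; case: i => [|i]; first by rewrite mul0r.
  by rewrite /= coef_deriv !mulr_natl.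
have g0 : g = 0.
  apply: IHs => //.
  - apply/leq_sizeP => j pj; rewrite gE.
    by move/leq_sizeP: sf => ->; rewrite ?mulr0.
  - move=> i si; rewrite gE; have [->|ie] := eqVneq i e; first by rewrite subrr mul0r.
    by rewrite f0 ?mulr0 // in_cons negb_or ie.
  - case/dvdpP: Xf => q fq; rewrite /g fq; apply: dvdp_sub.
      rewrite derivM deriv_exp -mulrnAl; apply/dvdp_mull/dvdp_add.
        by rewrite exprS !dvdp_mull.
      by rewrite /= !dvdp_mull.
    by rewrite scalerAl exprS mulrA dvdp_mull.
have fe i : i != e -> f`_i = 0.
  move=> ie; have [pi|ip] := leqP p i.
    by move/leq_sizeP: sf => ->.
  have /eqP := congr1 (fun h : {poly L} => h`_i) g0.
  rewrite gE coef0 mulf_eq0 => /orP[|/eqP//].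
  have ne a b : (b < a < p)%N -> a%:R - b%:R != 0 :> L.
    case/andP=> ba ap; rewrite -natrB ?(ltnW ba) // (natr_neq0_ltp pL) //.
    by rewrite subn_gt0 ba (leq_ltn_trans (leq_subr _ _)).
  move/negPn/negP; case; case: (ltngtP i e) ie => // [ie|ei] _.
    by rewrite -opprB oppr_eq0 ne // ie.
  by rewrite ne // ei.
have fE : f = f`_e *: 'X^e.
  apply/polyP=> i; rewrite coefZ coefXn; have [->|/fe->] := eqVneq i e.
    by rewrite mulr1.
  by rewrite mulr0.
have : root f 1.
  by rewrite -dvdp_XsubCl (dvdp_trans _ Xf) // exprS dvdp_mulr.
rewrite fE /root hornerZ hornerXn expr1n mulr1 => /eqP ->.
by rewrite scale0r.
Qed.

(** All terms but the one with l = B - 1 carry a factor E, so E divides the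
    top coefficient because it is coprime to N; then induct on B. *)
Lemma homog_sum_eq0 (L : fieldType) (E N : {poly L}) (B : nat) (F : nat -> {poly L}) :
  E != 0 -> coprimep E N ->
  (forall l, (l < B)%N -> E %| F l -> F l = 0) ->
  \sum_(l < B) F l * (N ^+ l * E ^+ (B.-1 - l)) = 0 ->
  forall l, (l < B)%N -> F l = 0.
Proof.
move=> E0 cEN; elim: B => [|B IHB] //= FE.
rewrite big_ord_recr /= subnn expr0 mulr1.
have -> : \sum_(l < B) F l * (N ^+ l * E ^+ (B - l)) =
   E * \sum_(l < B) F l * (N ^+ l * E ^+ (B.-1 - l)).
  rewrite mulr_sumr; apply: eq_bigr => -[l lB] _ /=.
  rewrite [RHS]mulrCA [E * _]mulrCA -exprS; congr (_ * (_ * _ ^+ _)).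
  by case: B lB {IHB FE} => //= B lB; rewrite subSn.
move=> S0.
have FB : F B = 0.
  apply: FE => //.
  have : E %| F B * N ^+ B.
    by move/eqP: S0; rewrite addrC addr_eq0 => /eqP->; rewrite dvdpNr dvdp_mulr.
  by rewrite Gauss_dvdpl // coprimep_expr.
move: S0; rewrite FB mul0r addr0 => /eqP; rewrite mulf_eq0 (negPf E0) /=.
move/eqP=> S0 l; rewrite ltnS leq_eqVlt => /predU1P[->//|lB].
by apply: IHB => // l' l'B; apply: FE; rewrite ltnS ltnW.
Qed.

(** * Power sums on the curve *)

(** Degrees are bounded with the convention that the zero polynomial has degree
    0, which makes the bounds additive under products. *)
Definition degle (L : nzRingType) (n : nat) (f : {poly L}) := (size f <= n.+1)%N.

Lemma degleD (L : nzRingType) n (f g : {poly L}) :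
  degle n f -> degle n g -> degle n (f + g).
Proof.
by rewrite /degle => fn gn; rewrite (leq_trans (size_polyD _ _)) // geq_max fn.
Qed.

Lemma degleN (L : nzRingType) n (f : {poly L}) : degle n (- f) = degle n f.
Proof. by rewrite /degle size_polyN. Qed.

Lemma degleM (L : nzRingType) m n k (f g : {poly L}) :
  degle m f -> degle n g -> (m + n <= k)%N -> degle k (f * g).
Proof. by rewrite /degle => fm gn; have := size_polyMleq f g; lia. Qed.

Lemma degle_exp (L : nzRingType) m k (f : {poly L}) :
  degle m f -> degle (m * k) (f ^+ k).
Proof.
move=> fm; elim: k => [|k IHk]; first by rewrite expr0 /degle size_poly1.
by rewrite exprS; apply: (degleM fm IHk); rewrite mulnS.
Qed.

Lemma degleX (L : nzRingType) n : degle n.+1 ('X : {poly L}).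
Proof. by rewrite /degle size_polyX. Qed.

Lemma degleC (L : nzRingType) n (a : L) : degle n a%:P.
Proof. by rewrite /degle (leq_trans (size_polyC_leq1 a)). Qed.

Lemma degle_nat (L : nzRingType) n k : degle n (k%:R : {poly L}).
Proof. by rewrite -polyC_natr degleC. Qed.

Lemma degle_deriv (L : nzRingType) n (f : {poly L}) :
  degle n f -> degle n.-1 f^`().
Proof.
rewrite /degle; have [->|f0] := eqVneq f 0; first by rewrite deriv0 size_poly0.
by have := lt_size_deriv f0; lia.
Qed.

Lemma derivCM (L : nzRingType) (a : L) (f : {poly L}) : (a%:P * f)^`() = a%:P * f^`().
Proof. by rewrite derivM derivC mul0r add0r. Qed.

Section Curve.
Variables (L : fieldType) (c eps : L).

Definition Epol : {poly L} := 'X ^+ 2 - 1.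
Definition Dpol : {poly L} := c%:P ^+ 2 * 'X ^+ 2 + 4%:R * eps%:P * Epol ^+ 2.

(** With Dpol the discriminant of z^2 - c X z - eps E^2, whose roots z, z' are
    E v and E v', the two components are z^n + z'^n and (z^n - z'^n) / (z - z');
    the recursion multiplies by z = (c X + sqrt Dpol) / 2. *)
Fixpoint lucas2 (n : nat) : {poly L} * {poly L} :=
  if n is n'.+1 then
    let: (P, Q) := lucas2 n' in
    ((2%:R^-1)%:P * (c%:P * 'X * P + Dpol * Q), (2%:R^-1)%:P * (c%:P * 'X * Q + P))
  else (2%:R, 0).

Definition Npol n := (lucas2 n).1.
Definition Mpol n := (lucas2 n).2.

Hypothesis two0 : 2%:R != 0 :> L.

Lemma NpolS n : 2%:R * Npol n.+1 = c%:P * 'X * Npol n + Dpol * Mpol n.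
Proof.
rewrite /Npol /Mpol /=; case: lucas2 => P Q /=.
by rewrite mulrA -polyC_natr -polyCM divff // mul1r.
Qed.

Lemma MpolS n : 2%:R * Mpol n.+1 = c%:P * 'X * Mpol n + Npol n.
Proof.
rewrite /Npol /Mpol /=; case: lucas2 => P Q /=.
by rewrite mulrA -polyC_natr -polyCM divff // mul1r.
Qed.

Let two0P : 2%:R != 0 :> {poly L}.
Proof. by rewrite -polyC_natr polyC_eq0. Qed.

Lemma deriv_Epol : Epol^`() = 2%:R * 'X.
Proof. by rewrite /Epol derivB derivXn -polyC1 derivC subr0 expr1 mulr_natl. Qed.

Lemma deriv_Dpol : Dpol^`() = 2%:R * (c%:P ^+ 2 * 'X + 8%:R * eps%:P * 'X * Epol).
Proof.
rewrite /Dpol -!polyC_exp -polyC_natr -!polyCM derivD !derivCM !deriv_exp deriv_Epol.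
by rewrite derivX !polyC_exp !polyCM !polyC_natr /=; ring.
Qed.

(** These formulas come from differentiating the curve equation, which gives
      (dv/du) / v = - c (u^2 + 1) (v - v1) / Dpol,   v1 = - eps / v,
    together with N + M sqrt Dpol = 2 (E v)^n.  They are verified by induction
    on n from the recursion, so that no square root is needed. *)
Lemma deriv_NMpol n :
  Epol * (Npol n)^`() = n%:R * (2%:R * 'X * Npol n - c%:P * ('X ^+ 2 + 1) * Mpol n) /\
  Epol * Dpol * (Mpol n)^`() =
    n%:R * (2%:R * 'X * Dpol * Mpol n - c%:P * ('X ^+ 2 + 1) * Npol n)
    - Epol * (c%:P ^+ 2 * 'X + 8%:R * eps%:P * 'X * Epol) * Mpol n.
Proof.
elim: n => [|n [IN IM]].
  by rewrite /Npol /Mpol /= -polyC_natr derivC deriv0; split; ring.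
have dN : 2%:R * (Npol n.+1)^`() = (c%:P * 'X * Npol n + Dpol * Mpol n)^`().
  by rewrite -NpolS -polyC_natr derivCM.
have dM : 2%:R * (Mpol n.+1)^`() = (c%:P * 'X * Mpol n + Npol n)^`().
  by rewrite -MpolS -polyC_natr derivCM.
move: dN dM; rewrite !derivD !derivM !derivC deriv_Dpol derivX => dN dM.
have NS := NpolS n; have MS := MpolS n.
have DE : Dpol = c%:P ^+ 2 * 'X ^+ 2 + 4%:R * eps%:P * Epol ^+ 2 by [].
have EE : Epol = 'X ^+ 2 - 1 by [].
move: IN IM NS MS dN dM DE EE.
move: (Npol n) (Npol n)^`() (Mpol n) (Mpol n)^`() (Npol n.+1) (Npol n.+1)^`()
  (Mpol n.+1) (Mpol n.+1)^`() Dpol Epol => N N' M M' N1 N1' M1 M1' D E.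
move=> IN IM NS MS dN dM DE EE.
split; apply: (mulfI two0P).
  rewrite (_ : _ * (E * _) = E * (2%:R * N1')); last by ring.
  rewrite dN.
  rewrite (_ : E * _ = E * c%:P * N + c%:P * 'X * (E * N')
    + 2%:R * E * (c%:P ^+ 2 * 'X + 8%:R * eps%:P * 'X * E) * M + E * D * M'); last by ring.
  rewrite IN IM.
  rewrite (_ : _ * (n.+1%:R * _) = n.+1%:R *
    (2%:R * 'X * (2%:R * N1) - c%:P * ('X ^+ 2 + 1) * (2%:R * M1))); last by ring.
  rewrite NS MS DE EE; ring.
rewrite (_ : _ * (E * D * _) = E * D * (2%:R * M1')); last by ring.
rewrite dM.
rewrite (_ : E * D * _ = E * D * c%:P * M + c%:P * 'X * (E * D * M') + D * (E * N')); last by ring.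
rewrite IN IM.
rewrite [RHS](_ : _ =
  n.+1%:R * (2%:R * 'X * D * (2%:R * M1) - c%:P * ('X ^+ 2 + 1) * (2%:R * N1))
  - E * (c%:P ^+ 2 * 'X + 8%:R * eps%:P * 'X * E) * (2%:R * M1)); last by ring.
rewrite NS MS DE EE; ring.
Qed.

Lemma degle_Epol : degle 2 Epol.
Proof. by rewrite /degle /Epol -polyC1 size_XnsubC. Qed.

Lemma degle_Dpol : degle 4 Dpol.
Proof.
have cc n (a : L) : degle n a%:P := degleC n a.
rewrite /Dpol; apply: degleD.
  by apply: (@degleM _ 0 2) => //; [exact: (@degle_exp _ 0)|exact: (@degle_exp _ 1 2 _ (degleX L 0))].
apply: (@degleM _ 0 4) => //; last exact: (@degle_exp _ 2 2 _ degle_Epol).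
by apply: (@degleM _ 0 0) => //; exact: degle_nat.
Qed.

Lemma degle_NMpol n :
  degle n.*2 (Npol n) /\ (size (Mpol n) <= n.*2.-1)%N.
Proof.
have cX : degle 1 (c%:P * 'X) by apply: (@degleM _ 0 1); rewrite ?degleC ?degleX.
elim: n => [|n [IN IM]]; first by rewrite /Npol /Mpol /= size_poly0 degle_nat.
have s2 (f : {poly L}) : size (2%:R * f) = size f.
  by rewrite -polyC_natr mul_polyC size_scale.
rewrite /degle -[size (Npol _)]s2 NpolS -[size (Mpol _)]s2 MpolS; split.
  apply: degleD; first by apply: (degleM cX IN); lia.
  have [->|M0] := eqVneq (Mpol n) 0; first by rewrite mulr0 /degle size_poly0.
  rewrite -size_poly_gt0 in M0; have n1 := leq_trans M0 IM.
  apply: (degleM degle_Dpol (_ : degle n.*2.-2 _)); last by lia.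
  by rewrite /degle (leq_trans IM) //; lia.
have -> : (n.+1.*2.-1 = n.*2.+1)%N by lia.
apply: degleD => //; have [->|M0] := eqVneq (Mpol n) 0.
  by rewrite mulr0 /degle size_poly0.
rewrite -size_poly_gt0 in M0; have n1 := leq_trans M0 IM.
apply: (degleM cX (_ : degle n.*2.-2 _)); last by lia.
by rewrite /degle (leq_trans IM) //; lia.
Qed.

Lemma horner_Dpol x : Dpol.[x] = (c * x) ^+ 2 + 4%:R * eps * Epol.[x] ^+ 2.
Proof.
rewrite /Dpol -polyC_natr hornerD !(horner_exp, hornerM) !hornerC hornerX.
by rewrite exprMn.
Qed.

Lemma horner_NMpol n (x z z' : L) :
  z + z' = c * x -> z * z' = - eps * Epol.[x] ^+ 2 ->
  (Npol n).[x] = z ^+ n + z' ^+ n /\ (z - z') * (Mpol n).[x] = z ^+ n - z' ^+ n.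
Proof.
move=> zD zM.
have D : Dpol.[x] = (z - z') ^+ 2.
  rewrite horner_Dpol -zD.
  by rewrite (_ : _ * eps * _ = - 4%:R * (z * z')); [ring | rewrite zM; ring].
elim: n => [|n [IN IM]].
  rewrite /Npol /Mpol /= -polyC_natr !hornerE; split; ring.
have dN := congr1 (fun h : {poly L} => h.[x]) (NpolS n).
have dM := congr1 (fun h : {poly L} => h.[x]) (MpolS n).
rewrite -polyC_natr hornerD !hornerM !hornerC !hornerX D IN -zD in dN.
rewrite -polyC_natr hornerD !hornerM !hornerC !hornerX IN -zD in dM.
split; apply: (mulfI two0).
  rewrite dN expr2 -mulrA IM !exprS; ring.
rewrite mulrCA dM mulrDr mulrCA IM !exprS; ring.
Qed.

(** Here z = E v and z' = - E eps / v, whose T-th powers are both E^T as T is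
    even; M vanishes because Dpol = (z - z')^2 does not. *)
Lemma NMpol_at_point T (x v : L) :
  eps ^+ 2 = 1 -> ~~ odd T -> v ^+ T = 1 -> v != 0 ->
  Epol.[x] * (v - eps / v) = c * x -> Dpol.[x] != 0 ->
  (Npol T).[x] = 2%:R * Epol.[x] ^+ T /\ (Mpol T).[x] = 0.
Proof.
move=> eps2 oT vT v0 xv D0.
pose z := Epol.[x] * v; pose z' := - (Epol.[x] * (eps / v)).
have zD : z + z' = c * x by rewrite -xv /z /z' mulrBr.
have zM : z * z' = - eps * Epol.[x] ^+ 2 by rewrite /z /z'; field.
have zT : z ^+ T = Epol.[x] ^+ T by rewrite exprMn vT mulr1.
have eT : eps ^+ T = 1.
  by rewrite -(odd_double_half T) (negPf oT) -mul2n exprM eps2 expr1n.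
have z'T : z' ^+ T = Epol.[x] ^+ T.
  by rewrite exprNn -signr_odd (negPf oT) mul1r exprMn expr_div_n eT vT divr1 mulr1.
have [N1 M1] := horner_NMpol T zD zM.
split; first by rewrite N1 zT z'T; ring.
move/eqP: M1; rewrite zT z'T subrr mulf_eq0 => /orP[|/eqP//].
rewrite subr_eq0 => /eqP zz; case/negP: D0.
apply/eqP; rewrite horner_Dpol -zD.
by rewrite (_ : _ * eps * _ = - 4%:R * (z * z')); [rewrite zz; ring | rewrite zM; ring].
Qed.

End Curve.

(** * Iterated derivatives of the auxiliary monomials *)

Section Jets.
Variables (L : fieldType) (c eps : L) (T : nat).
Hypothesis two0 : 2%:R != 0 :> L.

Local Notation E := (Epol L).
Local Notation D := (Dpol c eps).
Local Notation N := (Npol c eps T).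
Local Notation M := (Mpol c eps T).

(** The factors clear the denominators in the logarithmic derivatives of 'X
    and E, and in the derivatives of N and M. *)
Definition wpol : {poly L} := 'X * E * D.

(** The derivation maps N to a combination of N and M, so that it does not
    preserve the multiples of N^l; on these forms of degree l it only raises the
    degree k of the coefficients. *)
Inductive hform (k l : nat) : {poly L} -> Prop :=
| hform_monomial q i j : (i + j = l)%N -> degle k q -> hform k l (q * (N ^+ i * M ^+ j))
| hform_add f g : hform k l f -> hform k l g -> hform k l (f + g).

Lemma hform_at_point k l f : hform k l f ->
  exists2 g, degle k g & forall x, M.[x] = 0 -> f.[x] = g.[x] * N.[x] ^+ l.
Proof.
elim=> [q i j ij dq | f1 f2 _ [g1 d1 e1] _ [g2 d2 e2]].
  case: j ij => [|j] ij.
    exists q => // x _; rewrite expr0 mulr1 hornerM horner_exp.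
    by rewrite -ij addn0.
  exists 0; first by rewrite /degle size_poly0.
  by move=> x Mx; rewrite !hornerM !horner_exp Mx horner0 expr0n !mulr0 mul0r.
exists (g1 + g2); first exact: degleD.
by move=> x Mx; rewrite !hornerD e1 // e2 // mulrDl.
Qed.

Lemma degle_X2D1 : degle 2 ('X ^+ 2 + 1 : {poly L}).
Proof. by rewrite /degle -polyC1 size_XnaddC. Qed.

Lemma wderiv_N : wderiv wpol N =
  (T%:R * (2%:R * 'X * ('X * D))) * N + (- (T%:R * (c%:P * ('X ^+ 2 + 1) * ('X * D)))) * M.
Proof.
have [eN _] := deriv_NMpol c eps two0 T.
rewrite /wderiv /wpol (_ : _ * _ = 'X * D * (E * N^`())); last by ring.
by rewrite eN; ring.
Qed.

Lemma wderiv_M : wderiv wpol M =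
  (- (T%:R * (c%:P * ('X ^+ 2 + 1) * 'X))) * N +
  ('X * (T%:R * (2%:R * 'X * D) - E * (c%:P ^+ 2 * 'X + 8%:R * eps%:P * 'X * E))) * M.
Proof.
have [_ eM] := deriv_NMpol c eps two0 T.
rewrite /wderiv /wpol (_ : _ * _ = 'X * (E * D * M^`())); last by ring.
by rewrite eM; ring.
Qed.

Lemma degle_XD : degle 5 ('X * D).
Proof. by apply: (@degleM _ 1 4); rewrite ?degleX ?degle_Dpol. Qed.

Lemma degle_wpol : degle 7 wpol.
Proof.
apply: (@degleM _ 3 4); rewrite ?degle_Dpol //.
by apply: (@degleM _ 1 2); rewrite ?degleX ?degle_Epol.
Qed.

Lemma wderiv_Epol : wderiv wpol E = 2%:R * 'X * ('X * D) * E.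
Proof. by rewrite /wderiv /wpol deriv_Epol; ring. Qed.

(** The term h f accounts for the base factor X^a E^d, whose logarithmic
    derivative is h. *)
Lemma hform_wderiv k l (h f : {poly L}) : degle 7 h -> hform k l f ->
  hform (k + 7) l (h * f + wderiv wpol f).
Proof.
move=> dh; elim=> [q i j ij dq | f1 f2 _ I1 _ I2]; last first.
  rewrite (_ : _ + _ = (h * f1 + wderiv wpol f1) + (h * f2 + wderiv wpol f2)).
    exact: hform_add.
  by rewrite /wderiv derivD; ring.
have dX2 : degle 2 ('X ^+ 2 : {poly L}) by rewrite /degle size_polyXn.
pose n1 := T%:R * (2%:R * 'X * ('X * D)).
pose n2 := - (T%:R * (c%:P * ('X ^+ 2 + 1) * ('X * D))).
pose m1 := - (T%:R * (c%:P * ('X ^+ 2 + 1) * 'X)).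
pose m2 := 'X * (T%:R * (2%:R * 'X * D) - E * (c%:P ^+ 2 * 'X + 8%:R * eps%:P * 'X * E)).
have d2X : degle 1 (2%:R * 'X : {poly L}).
  by apply: (@degleM _ 0 1); rewrite ?degle_nat ?degleX.
have dcX : degle 2 (c%:P * ('X ^+ 2 + 1) : {poly L}).
  by apply: (@degleM _ 0 2); rewrite ?degleC ?degle_X2D1.
have dn1 : degle 7 n1.
  apply: (@degleM _ 0 7); rewrite ?degle_nat //.
  by apply: (degleM d2X degle_XD).
have dn2 : degle 7 n2.
  rewrite degleN; apply: (@degleM _ 0 7); rewrite ?degle_nat //.
  by apply: (degleM dcX degle_XD).
have dm1 : degle 7 m1.
  rewrite degleN; apply: (@degleM _ 0 7); rewrite ?degle_nat //.
  by apply: (degleM dcX (degleX L 0)).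
have dm2 : degle 7 m2.
  apply: (@degleM _ 1 6); rewrite ?degleX //; apply: degleD.
    apply: (@degleM _ 0 6); rewrite ?degle_nat //.
    by apply: (degleM d2X (degle_Dpol c eps)).
  rewrite degleN; apply: (@degleM _ 2 4); rewrite ?degle_Epol //; apply: degleD.
    apply: (@degleM _ 0 1); rewrite ?degleX //; exact: (@degle_exp _ 0 2 _ (degleC 0 c)).
  apply: (@degleM _ 1 2); rewrite ?degle_Epol //.
  apply: (@degleM _ 0 1); rewrite ?degleX //.
  by apply: (@degleM _ 0 0); rewrite ?degleC ?degle_nat.
have dq' : degle (k + 7) (wderiv wpol q).
  by rewrite addnC; apply: (degleM degle_wpol (degle_deriv dq)); lia.
have hyp a b r (s : nat) : (a + b = l)%N -> degle 7 r ->
    hform (k + 7) l (q * r * s%:R * (N ^+ a * M ^+ b)).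
  move=> ab dr; apply: hform_monomial => //.
  apply: (@degleM _ (k + 7) 0); rewrite ?addn0 ?degle_nat //.
  exact: (degleM dq dr).
have -> : h * (q * (N ^+ i * M ^+ j)) + wderiv wpol (q * (N ^+ i * M ^+ j)) =
   (q * h + wderiv wpol q) * (N ^+ i * M ^+ j) +
   (q * N ^+ i.-1 * M ^+ j * wderiv wpol N *+ i + q * N ^+ i * M ^+ j.-1 * wderiv wpol M *+ j).
  by rewrite /wderiv !derivM !deriv_exp; ring.
have zero_form x : hform (k + 7) l (x *+ 0).
  rewrite mulr0n -(mul0r (N ^+ l * M ^+ 0)).
  by apply: hform_monomial; rewrite ?addn0 // /degle size_poly0.
apply: hform_add.
  by apply: hform_monomial => //; apply: degleD => //; apply: (degleM dq dh).
rewrite wderiv_N wderiv_M -/n1 -/n2 -/m1 -/m2.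
apply: hform_add.
  case: i ij => [|i] ij; first exact: zero_form.
  rewrite (_ : _ *+ _ = q * n1 * i.+1%:R * (N ^+ i.+1 * M ^+ j)
    + q * n2 * i.+1%:R * (N ^+ i * M ^+ j.+1)); last by rewrite /= !exprS; ring.
  by apply: hform_add; apply: hyp => //; lia.
case: j ij => [|j] ij; first exact: zero_form.
rewrite (_ : _ *+ _ = q * m1 * j.+1%:R * (N ^+ i.+1 * M ^+ j)
    + q * m2 * j.+1%:R * (N ^+ i * M ^+ j.+1)); last by rewrite /= !exprS; ring.
by apply: hform_add; apply: hyp => //; lia.
Qed.

Lemma wderiv_base a d :
  exists2 h, degle 7 h & forall f : {poly L},
    wderiv wpol ('X ^+ a * E ^+ d * f) = 'X ^+ a * E ^+ d * (h * f + wderiv wpol f).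
Proof.
exists (a%:R * (E * D) + d%:R * (2%:R * 'X * ('X * D))).
  apply: degleD; apply: (@degleM _ 0 7); rewrite ?degle_nat //.
    by apply: (degleM (degle_Epol L) (degle_Dpol c eps)).
  apply: (degleM (_ : degle 1 _) degle_XD) => //.
  by apply: (@degleM _ 0 1); rewrite ?degle_nat ?degleX.
move=> g.
have wXa : wderiv wpol ('X ^+ a) = a%:R * (E * D) * 'X ^+ a.
  rewrite /wderiv /wpol derivXn; case: a => [|a]; first by rewrite mulr0n; ring.
  by rewrite /= exprS; ring.
have wEd : wderiv wpol (E ^+ d) = d%:R * (2%:R * 'X * ('X * D)) * E ^+ d.
  rewrite /wderiv deriv_exp; case: d => [|d]; first by rewrite mulr0n; ring.
  rewrite (_ : _ * _ = d.+1%:R * wderiv wpol E * E ^+ d).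
    by rewrite wderiv_Epol exprS; ring.
  by rewrite /wderiv /=; ring.
rewrite (_ : wderiv wpol _ = wderiv wpol ('X ^+ a) * E ^+ d * g
    + 'X ^+ a * wderiv wpol (E ^+ d) * g + 'X ^+ a * E ^+ d * wderiv wpol g).
  by rewrite wXa wEd; ring.
by rewrite /wderiv !derivM; ring.
Qed.

(** The bound on the degree of g does not depend on a, d and l: this is why
    vanishing to a high order costs few linear conditions, although the
    polynomial itself has large degree. *)
Lemma iter_wderiv_at_point a d l m :
  exists2 g, degle (7 * m) g & forall x, M.[x] = 0 ->
    (iter m (wderiv wpol) ('X ^+ a * E ^+ d * N ^+ l)).[x] =
    x ^+ a * E.[x] ^+ d * (g.[x] * N.[x] ^+ l).
Proof.
suff [f ff ->] : exists2 f, hform (7 * m) l f &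
    iter m (wderiv wpol) ('X ^+ a * E ^+ d * N ^+ l) = 'X ^+ a * E ^+ d * f.
  have [g dg fg] := hform_at_point ff; exists g => // x Mx.
  by rewrite hornerM fg // hornerM !horner_exp hornerX.
elim: m => [|m [f ff IH]] /=.
  exists (N ^+ l) => //; rewrite -[N ^+ l]mul1r -[N ^+ l]mulr1 -[X in _ * (_ * X)](expr0 M).
  by apply: hform_monomial; rewrite ?addn0 // /degle size_poly1.
have [h dh hE] := wderiv_base a d.
exists (h * f + wderiv wpol f); last by rewrite IH hE.
by rewrite mulnS addnC; apply: hform_wderiv.
Qed.

End Jets.

(** * The auxiliary polynomial *)

Lemma nonzero_dependency (L : fieldType) (I J : finType) (C : I -> J -> L) :
  (#|J| < #|I|)%N ->
  exists2 a : I -> L, exists i, a i != 0 & forall j, \sum_i a i * C i j = 0.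
Proof.
move=> JI; pose A := \matrix_(i < #|I|, j < #|J|) C (enum_val i) (enum_val j).
have : kermx A != 0.
  by rewrite -mxrank_eq0 mxrank_ker -lt0n subn_gt0 (leq_ltn_trans (rank_leq_col A)).
case/rowV0Pn=> v /sub_kermxP vA v0.
exists (fun i => v 0 (enum_rank i)).
  case/rV0Pn: v0 => i vi; exists (enum_val i).
  by rewrite enum_valK.
move=> j; rewrite (reindex (@enum_val I I)) /=; last by apply: onW_bij; apply: enum_val_bij.
have := congr1 (fun B : 'rV_ _ => B 0 (enum_rank j)) vA; rewrite !mxE => vA0; rewrite -[RHS]vA0.
by apply: eq_bigr => i _; rewrite !mxE enum_valK enum_rankK.
Qed.

Section Auxiliary.
Variables (L : fieldType) (c eps : L) (T : nat).
Hypothesis two0 : 2%:R != 0 :> L.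
Hypothesis c0 : c != 0.
Hypothesis T0 : (0 < T)%N.

Local Notation E := (Epol L).
Local Notation N := (Npol c eps T).
Local Notation M := (Mpol c eps T).
Local Notation w := (wpol c eps).

Lemma Epol_factor : E = ('X - 1%:P) * ('X - (-1)%:P).
Proof. by rewrite /Epol polyCN polyC1; ring. Qed.

(** At the roots x = 1, -1 of E one of z, z' is 0 and the other c x, so that
    N takes the value (c x)^T. *)
Lemma coprimep_Epol_Npol : coprimep (E ^+ T) N.
Proof.
have Nx x : E.[x] = 0 -> x != 0 -> ~~ root N x.
  move=> Ex x0; have [||N1 _] := @horner_NMpol L c eps two0 T x (c * x) 0.
  - by rewrite addr0.
  - by rewrite Ex expr2 !mulr0.
  by rewrite rootE N1 expr0n gtn_eqF // addr0 expf_neq0 // mulf_neq0.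
rewrite coprimep_expl // Epol_factor coprimepMl !(coprimep_sym _ N) !coprimep_XsubC.
by rewrite !Nx ?oppr_eq0 ?oner_eq0 // Epol_factor !hornerE; ring.
Qed.

Variables (A B : nat).

Definition auxpol (r : 'I_A * 'I_B * 'I_B) : {poly L} :=
  'X ^+ (r.1.1 + T * r.1.2) * E ^+ (T * (B.-1 - r.2)) * N ^+ r.2.

(** The coefficient of N^l is a polynomial with A B terms, because the
    exponents i + T k with i < A <= T are distinct. *)
Lemma auxpol_free (p : nat) (a : 'I_A * 'I_B * 'I_B -> L) :
  p \in [pchar L] -> (A <= T)%N -> (A * B <= T)%N -> (A + T * B.-1 <= p)%N ->
  \sum_r a r *: auxpol r = 0 -> forall r, a r = 0.
Proof.
move=> pL AT ABT ABp S0.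
pose ex (ik : 'I_A * 'I_B) := (ik.1 + T * ik.2)%N.
have ex_inj : injective ex.
  case=> i k [i' k'] /= /(congr1 (fun x => (x %% T, x %/ T)%N)) [].
  rewrite /ex /= !(addnC _ (T * _)%N) !(mulnC T) !modnMDl !divnMDl //.
  have iT (j : 'I_A) : (j < T)%N by apply: leq_trans AT.
  by rewrite !modn_small // !divn_small // !addn0 => /val_inj -> /val_inj ->.
(* [homog_sum_eq0] indexes coefficients by nat; b extends a by 0. *)
pose b ik l := oapp (fun l' : 'I_B => a (ik, l')) 0 (insub l).
pose F l := \sum_(ik : 'I_A * 'I_B) b ik l *: 'X ^+ ex ik.
have Fcoef l ik : (F l)`_(ex ik) = b ik l.
  rewrite coef_sum (bigD1 ik) //= coefZ coefXn eqxx mulr1 big1 ?addr0 // => j ji.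
  by rewrite coefZ coefXn (inj_eq ex_inj) eq_sym (negPf ji) mulr0.
suff Fl l : (l < B)%N -> F l = 0.
  case=> ik l; have := Fcoef l ik; rewrite Fl // coef0 /b valK /=.
  by move=> <-.
move: l; apply: (@homog_sum_eq0 L (E ^+ T) N) => //.
- by rewrite expf_neq0 // Epol_factor mulf_neq0 // polyXsubC_eq0.
- exact: coprimep_Epol_Npol.
- move=> l lB EF; apply: (@lacunary_dvdp_eq0 L p [seq ex ik | ik : 'I_A * 'I_B]) => //.
  + apply/allP=> e /imageP[[i k] _ ->]; apply: leq_trans ABp.
    rewrite /ex /= -addSn leq_add // leq_mul2l -ltnS (leq_trans (ltn_ord k)) ?orbT //.
    exact: leqSpred.
  + apply/leq_sizeP => j pj; rewrite coef_sum big1 // => -[i k] _.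
    rewrite coefZ coefXn; case: eqP => [je|]; last by rewrite mulr0.
    move: pj; rewrite je leqNgt; case/negP; apply: leq_trans ABp.
    rewrite /ex /= -addSn leq_add // leq_mul2l -ltnS (leq_trans (ltn_ord k)) ?orbT //.
    exact: leqSpred.
  + move=> j js; rewrite coef_sum big1 // => ik _; rewrite coefZ coefXn.
    case: eqP => [je|]; last by rewrite mulr0.
    by case/negP: js; rewrite je image_f.
  rewrite size_image card_prod !card_ord; apply: dvdp_trans EF.
  rewrite -polyC1 Epol_factor exprMn dvdp_mulr //.
  exact: dvdp_exp2l.
rewrite -[RHS]S0.
transitivity (\sum_ik \sum_l a (ik, l) *: auxpol (ik, l)); last first.
  by rewrite pair_bigA; apply: eq_bigr => -[].
rewrite exchange_big /=.
apply: eq_bigr => l _; rewrite mulr_suml; apply: eq_bigr => ik _.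
rewrite /b valK /= /auxpol /= -scalerAl; congr (_ *: _).
by rewrite -mulrA exprM [X in _ * X]mulrC.
Qed.

Lemma iter_wderiv_sum (I : finType) (a : I -> L) (f : I -> {poly L}) j :
  iter j (wderiv w) (\sum_i a i *: f i) = \sum_i a i *: iter j (wderiv w) (f i).
Proof.
elim: j => //= j ->; rewrite /wderiv raddf_sum mulr_sumr; apply: eq_bigr => i _.
by rewrite /= derivZ scalerAr.
Qed.

(** Solve the linear conditions that make the derivatives of order less than m
    of the auxiliary polynomial vanish on s, then count zeros. *)
Lemma stepanov_bound (p m : nat) (s : seq L) :
  p \in [pchar L] -> (A <= T)%N -> (A * B <= T)%N -> (A + T * B.-1 <= p)%N ->
  (m <= p)%N -> (m * (A + 7 * m) < A * B * B)%N ->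
  uniq s ->
  (forall x, x \in s ->
    [/\ x ^+ T = 1, N.[x] = 2%:R * E.[x] ^+ T, M.[x] = 0 & w.[x] != 0]) ->
  (size s * m < A + 3 * T * B.-1)%N.
Proof.
move=> pL AT ABT ABp mp cond us sP.
pose G (j : 'I_m) (r : 'I_A * 'I_B * 'I_B) (g : {poly L}) :=
  degle (7 * j) g /\ forall x, x \in s ->
    (iter j (wderiv w) (auxpol r)).[x] =
      E.[x] ^+ (T * B.-1) * (2%:R ^+ r.2 *: ('X ^+ r.1.1 * g)).[x].
have /fin_all_exists[g gP] : forall jr : 'I_m * ('I_A * 'I_B * 'I_B), exists g, G jr.1 jr.2 g.
  case=> j [[i k] l]; rewrite /G /=.
  have [g dg gE] := iter_wderiv_at_point c eps T two0 (i + T * k) (T * (B.-1 - l)) l j.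
  exists g; split=> // x /sP[xT Nx Mx _]; rewrite gE // Nx hornerZ hornerM hornerXn.
  rewrite exprD exprM xT expr1n mulr1 exprMn -exprM.
  have -> : (T * B.-1 = T * (B.-1 - l) + T * l)%N.
    rewrite -mulnDr subnK // -ltnS (leq_trans (ltn_ord l)) //; exact: leqSpred.
  by rewrite exprD; ring.
(* On s, the j-th derivatives of the auxiliary monomials are the values of the
   polynomials h j r, up to a factor that does not depend on r; it is these
   polynomials whose linear combination is made to vanish identically. *)
pose h j r := 2%:R ^+ (r.2 : 'I_B) *: ('X ^+ (r.1.1 : 'I_A) * g (j, r)).
have sh j r : (size (h j r) <= A + 7 * m)%N.
  have [dg _] := gP (j, r).
  rewrite (leq_trans (size_scale_leq _ _)) // (leq_trans (size_polyMleq _ _)) //.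
  rewrite size_polyXn /=; rewrite /degle /= in dg.
  apply: leq_trans (leq_add (leqnn _) dg) _.
  by rewrite leq_add ?ltn_pmul2l // ltnW.
have [|a [r0 ar0] aP] := @nonzero_dependency L _ ('I_m * 'I_(A + 7 * m))%type
    (fun r je => (h je.1 r)`_je.2).
  by rewrite !card_prod !card_ord.
have hz j : \sum_r a r *: h j r = 0.
  apply/polyP=> e; rewrite coef0 coef_sum.
  have [eA|eA] := ltnP e (A + 7 * m).
    rewrite -[RHS](aP (j, Ordinal eA)) /=.
    by apply: eq_bigr => r _; rewrite coefZ.
  rewrite big1 // => r _; rewrite coefZ nth_default ?mulr0 //.
  exact: leq_trans eA.
pose Psi := \sum_r a r *: auxpol r.
have Psi0 : Psi != 0.
  apply: contra ar0 => /eqP Psi0; apply/eqP.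
  exact: (auxpol_free pL AT ABT ABp Psi0).
have sPsi : (size Psi <= A + 3 * T * B.-1)%N.
  apply/(leq_trans (size_sum _ _ _))/bigmax_leqP => -[[i k] l] _.
  rewrite (leq_trans (size_scale_leq _ _)) // /auxpol /=.
  have lB : (l <= B.-1)%N by rewrite -ltnS (leq_trans (ltn_ord l)) // leqSpred.
  have kB : (k <= B.-1)%N by rewrite -ltnS (leq_trans (ltn_ord k)) // leqSpred.
  have iA := ltn_ord i.
  have -> : (A + 3 * T * B.-1 = (A.-1 + 3 * T * B.-1).+1)%N by lia.
  have [dN _] := degle_NMpol c eps two0 T.
  apply: (@degleM _ (i + T * k + 2 * (T * (B.-1 - l))) (T.*2 * l)).
  - apply: (@degleM _ (i + T * k) (2 * (T * (B.-1 - l)))) => //.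
      by rewrite /degle size_polyXn.
    exact: degle_exp (degle_Epol L).
  - exact: degle_exp dN.
  have : (T * k <= T * B.-1)%N by rewrite leq_mul2l kB orbT.
  have : (T * (B.-1 - l) + T * l = T * B.-1)%N by rewrite -mulnDr subnK.
  by rewrite -mulnA -[T.*2]mul2n -mulnA; lia.
apply: leq_trans sPsi; apply: size_dvdp_prod_XsubC => // x xs.
have [_ _ _ wx] := sP x xs.
apply: (dvdp_exp_wderiv pL wx) => // j jm.
rewrite iter_wderiv_sum horner_sum.
transitivity (E.[x] ^+ (T * B.-1) * (\sum_r a r *: h (Ordinal jm) r).[x]); last first.
  by rewrite hz horner0 mulr0.
rewrite horner_sum mulr_sumr; apply: eq_bigr => r _.
by have [_ /(_ x xs) /= e] := gP (Ordinal jm, r); rewrite !hornerZ e hornerZ mulrCA.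
Qed.

End Auxiliary.

(** * Points of the curve over roots of unity *)

Lemma Dpol_neq0 (L : fieldType) (c eps : L) :
  2%:R != 0 :> L -> eps != 0 -> Dpol c eps != 0.
Proof.
move=> two0 e0; apply/eqP=> D0.
have := horner_Dpol c eps 0; rewrite D0 horner0 => /eqP.
have -> : (Epol L).[0] = -1 by rewrite /Epol !hornerE /=; ring.
rewrite eq_sym mulr0 expr0n add0r sqrrN expr1n mulr1; apply/negP.
by rewrite mulf_neq0 // (natrM _ 2 2) mulf_neq0.
Qed.

(** The parameters A = n^2, B = n, m = n^2/8 satisfy A B <= T and
    m (A + 7m) < A B^2, and (A + 3T(B-1)) / m = O(T / n) = O(n^2).  The at most
    four zeros of Dpol are the values of u over which the two points of the
    curve coincide; Stepanov's argument does not apply to them. *)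
Lemma curve_subgroup_bound (L : fieldType) (p : nat) (c eps : L) (T n : nat) (s : seq L) :
  p \in [pchar L] -> c != 0 -> eps ^+ 2 = 1 ->
  ~~ odd T -> (0 < T)%N -> (T ^ 4 < p ^ 3)%N -> (n ^ 3 <= T < n.+1 ^ 3)%N ->
  uniq s ->
  (forall x, x \in s -> x ^+ T = 1 /\
     exists2 v, v ^+ T = 1 & (x - x^-1) * (v - eps / v) = c) ->
  (size s <= 388 * n ^ 2)%N.
Proof.
move=> pL c0 eps2 oT T0 Tp /andP[nT Tn] us sP.
have n0 : (0 < n)%N by case: n Tn {nT} => //; rewrite exp1n ltnS leqn0 => /eqP T1; rewrite T1 in T0.
have T2 : (2 <= T)%N by case: T oT T0 {nT Tn Tp sP} => [|[|]].
have p2 : (2 < p)%N.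
  rewrite ltnNge; apply/negP => p2; move: Tp; apply/negP; rewrite -leqNgt.
  apply: (@leq_trans (2 ^ 3)); first by rewrite leq_exp2r.
  by apply: (@leq_trans (2 ^ 4)); rewrite ?leq_exp2r.
have two0 : 2%:R != 0 :> L by rewrite (natr_neq0_ltp pL).
have eps0 : eps != 0 by apply: contra_eq_neq eps2 => ->; rewrite expr0n eq_sym oner_eq0.
have n1 : (n.+1 <= 2 * n)%N by lia.
have T8 : (T < 8 * n ^ 3)%N.
  by apply: (leq_trans Tn); rewrite (_ : 8 = 2 ^ 3)%N // -expnMn leq_exp2r.
have n23 : (n ^ 2 <= n ^ 3)%N by rewrite leq_pexp2l.
have rootsD : (size [seq x <- s | root (Dpol c eps) x] <= 4)%N.
  have := max_poly_roots (Dpol_neq0 c two0 eps0) (filter_all _ s) (filter_uniq _ us).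
  by move=> /leq_trans/(_ (degle_Dpol c eps)).
pose s' := [seq x <- s | ~~ root (Dpol c eps) x].
have ss' : (size s <= size s' + 4)%N.
  rewrite -(count_predC (root (Dpol c eps)) s) [X in (X <= _)%N]addnC.
  by apply: leq_add; [rewrite size_filter | rewrite -size_filter].
pose m := (n ^ 2 %/ 8)%N.
have s'P : (size s' * m < n ^ 2 + 3 * T * n.-1)%N.
  have Tnp : (T * n <= p)%N.
    rewrite -(@leq_exp2r _ _ 3) // expnMn ltnW //; apply: leq_ltn_trans Tp.
    by rewrite (expnSr T 3) leq_mul2l nT orbT.
  apply: (@stepanov_bound L c eps T two0 c0 T0 _ _ p) => //.
  - exact: leq_trans nT.
  - by rewrite -expnSr.
  - apply: leq_trans Tnp; rewrite -[X in (_ <= _ * X)%N](prednK n0) mulnS leq_add2r.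
    exact: leq_trans nT.
  - apply: leq_trans (leq_div _ _) _; apply: leq_trans Tnp.
    by apply: leq_trans (leq_pmulr _ n0); exact: leq_trans nT.
  - have m8 : (8 * m <= n ^ 2)%N by rewrite mulnC leq_trunc_div.
    have : (0 < n ^ 2)%N by rewrite expn_gt0 n0.
    rewrite -mulnA -[(n * n)%N]/(n ^ 2)%N; move: (n ^ 2)%N m m8 => N m m8 N0.
    by nia.
  - exact: filter_uniq.
  - move=> x; rewrite mem_filter => /andP[Dx /sP[xT [v vT xv]]].
    have nz (y : L) : y ^+ T = 1 -> y != 0.
      move=> yT; apply: contra_eq_neq yT => ->.
      by rewrite expr0n gtn_eqF // eq_sym oner_eq0.
    have x0 := nz x xT; have v0 := nz v vT.
    have Exv : (Epol L).[x] * (v - eps / v) = c * x.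
      rewrite -xv /Epol hornerD hornerN !hornerE; field; rewrite x0 v0 //.
    have [] := @NMpol_at_point L c eps two0 T x v eps2 oT vT v0 Exv Dx.
    split=> //; rewrite /wpol !hornerM hornerX !mulf_neq0 //.
    apply/eqP=> Ex; move/eqP: Exv; rewrite Ex mul0r eq_sym mulf_eq0.
    by rewrite (negPf c0) (negPf x0).
(* For n < 3 the order m is 0, and the trivial bound by T is good enough. *)
have [n3|n3] := ltnP n 3.
  have sT : (size s <= T)%N.
    have TP : ('X^T - 1%:P : {poly L}) != 0 by rewrite -size_poly_gt0 size_XnsubC.
    have := @max_poly_roots _ _ s TP _ us; rewrite size_XnsubC // ltnS; apply.
    by apply/allP=> x /sP[xT _]; rewrite rootE !hornerE xT subrr.
  apply: (leq_trans sT); move: T8; case: n n0 n3 {nT Tn n1 n23 m s'P} => [|[|[|]]] // _ _; lia.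
have m1 : (0 < m)%N.
  by rewrite divn_gt0 // (@leq_trans (3 ^ 2)) // leq_exp2r.
have m16 : (n ^ 2 <= 16 * m)%N.
  have := divn_eq (n ^ 2) 8; have : (n ^ 2 %% 8 < 8)%N by rewrite ltn_pmod.
  rewrite -/m; lia.
have : (size s' * n ^ 2 <= 384 * n ^ 2 * n ^ 2)%N.
  apply: (@leq_trans (16 * (3 * T * n))%N).
    rewrite (leq_trans (leq_mul (leqnn _) m16)) // mulnCA leq_mul2l /=.
    rewrite (leq_trans (ltnW s'P)) // -[X in (_ <= _ * X)%N](prednK n0) mulnS leq_add2r.
    by rewrite (leq_trans (leq_trans n23 nT)) // leq_pmull.
  apply: (@leq_trans (16 * (3 * (8 * n ^ 3) * n))%N).
    by rewrite leq_mul2l /= leq_mul2r leq_mul2l /= ltnW ?orbT.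
  by rewrite leq_eqVlt; apply/orP; left; apply/eqP; ring.
rewrite leq_pmul2r ?expn_gt0 ?n0 // => s384.
apply: (leq_trans ss'); rewrite (_ : 388 = 384 + 4)%N // mulnDl leq_add //.
by rewrite leq_pmulr // expn_gt0 n0.
Qed.

(** * Counting by fibers and the roots of the characteristic polynomial *)

Lemma size_le_fibers (X : Type) (Y : eqType) (f : X -> Y) (U : seq Y) (l : seq X) (k : nat) :
  all (fun x => f x \in U) l ->
  (forall y, y \in U -> (size [seq x <- l | f x == y] <= k)%N) ->
  (size l <= size U * k)%N.
Proof.
elim: U l => [|y U IHU] l lU lk /=; first by case: l lU {lk}.
rewrite -(count_predC (fun x => f x == y)) -!size_filter mulSn leq_add //.
  by rewrite lk ?mem_head.
apply: IHU => [|y' y'U].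
  rewrite all_filter; apply: sub_all lU => x; rewrite in_cons /=.
  by case: eqP.
  apply: leq_trans (lk y' _); last by rewrite in_cons y'U orbT.
rewrite -filter_predI !size_filter; apply: sub_count => x /andP[].
by [].
Qed.

Lemma size_le_roots (X : eqType) (L : fieldType) (f : X -> L) (l : seq X) (q : seq L) :
  uniq l -> {in l &, injective f} -> Poly q != 0 ->
  (forall x, x \in l -> (Poly q).[f x] = 0) -> (size l <= (size q).-1)%N.
Proof.
move=> ul fi q0 fq.
have /max_poly_roots/(_ (_ : all _ (map f l))) : Poly q != 0 by [].
rewrite size_map map_inj_in_uniq // => /(_ _ ul) H.
have {}H : (size l < size (Poly q))%N.
  by apply: H; apply/allP=> _ /mapP[x xl ->]; rewrite rootE fq.
by have := leq_trans H (size_Poly q); case: (size q).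
Qed.

Lemma fib_roots (p : nat) (K : 'F_p) : exists (L : fieldType) (iota : {rmorphism 'F_p -> L})
   (a b : L), [/\ a + b = iota K, a * b = -1 & exists2 n, (0 < n)%N & a ^+ n = 1].
Proof.
pose f : {poly 'F_p} := 'X^2 - K%:P * 'X - 1.
have sf : (2 < size f)%N.
  rewrite ltnNge; apply/negP => /leq_sizeP/(_ 2%N (leqnn _)) /eqP.
  by rewrite /f !coefB coefXn coefCM coefX coef1 !subr0 mulr0 subr0 oner_eq0.
have f0 : f != 0 by rewrite -size_poly_gt0 (ltn_trans _ sf).
have [L [rs frs _]] := FinSplittingFieldFor f0.
case: rs frs => [|a rs] frs.
  move/eqp_size: frs; rewrite big_nil size_poly1 size_map_poly => s1.
  by rewrite s1 in sf.
exists L, (in_alg L), a, (in_alg L K - a).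
have /eqP ra : root (map_poly (in_alg L) f) a.
  by rewrite (eqp_root frs) root_prod_XsubC mem_head.
rewrite /f !rmorphB /= rmorphXn rmorphM /= map_polyC map_polyX rmorph1 in ra.
rewrite !hornerE /= in ra.
have {}ra : a ^+ 2 - K%:A * a = 1 by apply/eqP; rewrite -subr_eq0 ra.
have ab : a * (in_alg L K - a) = -1.
  rewrite /= -[in RHS]ra; ring.
split=> //; first by rewrite addrC subrK.
have a0 : a != 0 by apply: contra_eq_neq ab => ->; rewrite mul0r eq_sym oppr_eq0 oner_eq0.
have := @expf_card (FinFieldExtType L) a; set N := #|_| => aN.
have N1 : (1 < N)%N by exact: finNzRing_gt1.
exists N.-1; first by rewrite -subn1 subn_gt0.
by apply: (mulfI a0); rewrite -exprS prednK ?mulr1 // ltnW.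
Qed.

(** * Representations by sums and products *)

Lemma binet (p : nat) (K : 'F_p) (L : fieldType) (iota : {rmorphism 'F_p -> L})
    (a b : L) (n : nat) :
  a + b = iota K -> a * b = -1 -> (a - b) * iota (kfib K n) = a ^+ n - b ^+ n.
Proof.
move=> ab ab1.
suff [] : (a - b) * iota (kfib K n) = a ^+ n - b ^+ n /\
          (a - b) * iota (kfib K n.+1) = a ^+ n.+1 - b ^+ n.+1 by [].
elim: n => [|n [I0 I1]]; first by rewrite /= rmorph0 rmorph1; split; ring.
split=> //; have -> : kfib K n.+2 = K * kfib K n.+1 + kfib K n by [].
rewrite rmorphD rmorphM mulrDr mulrCA I0 I1 -ab.
rewrite (_ : a ^+ n - b ^+ n = - (a * b) * (a ^+ n - b ^+ n)).
  by rewrite !exprS; ring.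
by rewrite ab1; ring.
Qed.

(** If the characteristic polynomial has a double root a, then
    F_(n+1) = (n+1) a^n with a^4 = 1, so F_(4k+1) = 4k+1 takes all values
    as p is odd. *)
Lemma kfib_set_full (p : nat) (K : 'F_p) (L : fieldType) (iota : {rmorphism 'F_p -> L})
    (a : L) :
  prime p -> (2 < p)%N -> a + a = iota K -> a * a = -1 -> #|kfib_set K| = p.
Proof.
move=> pp p2 aK a1.
have F n : iota (kfib K n.+1) = n.+1%:R * a ^+ n.
  suff [] : a * iota (kfib K n) = n%:R * a ^+ n /\ iota (kfib K n.+1) = n.+1%:R * a ^+ n by [].
  elim: n => [|n [I0 I1]]; first by rewrite /= rmorph0 rmorph1; split; ring.
  split; first by rewrite I1 exprS; ring.
  have -> : kfib K n.+2 = K * kfib K n.+1 + kfib K n by [].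
  rewrite rmorphD rmorphM I1 -aK.
  have a0 : a != 0 by apply: contra_eq_neq a1 => ->; rewrite mul0r eq_sym oppr_eq0 oner_eq0.
  apply: (mulfI a0); rewrite mulrDr I0.
  rewrite (_ : n%:R * a ^+ n = - (a * a) * (n%:R * a ^+ n)); last by rewrite a1; ring.
  by rewrite !exprS -!natr1; ring.
have a4 : a ^+ 4 = 1.
  by transitivity ((a * a) ^+ 2); [ring | rewrite a1 sqrrN expr1n].
have F4 k : kfib K (4 * k).+1 = (4 * k).+1%:R.
  by apply: (fmorph_inj iota); rewrite F exprM a4 expr1n mulr1 rmorph_nat.
have four0 : 4%:R != 0 :> 'F_p.
  have two0 : 2%:R != 0 :> 'F_p by rewrite (natr_neq0_ltp (pchar_Fp pp)).
  by rewrite (natrM _ 2 2) mulf_neq0.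
rewrite -[RHS](card_Fp pp); apply/eqP; rewrite -cardsT; apply/eqP/eq_card => x.
rewrite !inE; apply/asboolP; exists (4 * ((x - 1) / 4%:R : 'F_p)).+1.
rewrite F4 -natr1 natrM natr_Zp; field; exact: four0.
Qed.

Section Counting.
Variables (p : nat) (K : 'F_p) (L : fieldType) (iota : {rmorphism 'F_p -> L}).
Variables (a b : L) (t : nat).
Hypothesis pp : prime p.
Hypothesis abK : a + b = iota K.
Hypothesis ab1 : a * b = -1.
Hypothesis aNb : a - b != 0.
Hypothesis prim : t.-primitive_root (a ^+ 2).

Let g := a ^+ 2.

Let t_gt0 : (0 < t)%N. Proof. exact: prim_order_gt0 prim. Qed.

Let g_neq0 : g != 0.
Proof.
by rewrite /g expf_neq0 //; apply: contra_eq_neq ab1 => ->; rewrite mul0r eq_sym oppr_eq0 oner_eq0.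
Qed.

Let pow_inj : injective (fun i : 'I_t => g ^+ i).
Proof.
move=> i j /eqP; rewrite (eq_prim_root_expr prim) !modn_small // => /eqP; exact: val_inj.
Qed.

Lemma binet_even n : (a - b) * iota (kfib K (2 * n)) = g ^+ n - (g ^+ n)^-1.
Proof.
rewrite (binet _ abK ab1) /g -exprM; congr (_ - _).
have g0 : a ^+ (2 * n) != 0 by rewrite exprM expf_neq0.
apply: (mulfI g0); rewrite divff // -exprMn ab1 exprM sqrrN expr1n expr1n //.
Qed.

Lemma card_kfib_set_le : (#|kfib_set K| <= 2 * t)%N.
Proof.
have gt : a ^+ (2 * t) = 1 by rewrite exprM (prim_expr_order prim).
have bt : b ^+ (2 * t) = 1.
  by rewrite -[LHS]mul1r -gt -exprMn ab1 exprM sqrrN !expr1n.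
apply: (@leq_trans #|[set kfib K i | i : 'I_(2 * t)]|).
  apply/subset_leq_card/subsetP => x; rewrite inE => /asboolP[n ->].
  have nt : (n %% (2 * t) < 2 * t)%N by rewrite ltn_pmod // muln_gt0.
  apply/imsetP; exists (Ordinal nt) => //=; apply: (fmorph_inj iota).
  apply: (mulfI aNb); rewrite !(binet _ abK ab1).
  by rewrite -(expr_mod _ gt) -[b ^+ n](expr_mod _ bt).
by rewrite (leq_trans (leq_imset_card _ _)) // card_ord.
Qed.

(** The equation h - 1/h = y has at most two solutions h. *)
Lemma order_le : (t <= 2 * #|kfib_set K|)%N.
Proof.
rewrite -[t]size_enum_ord mulnC cardE.
apply: (size_le_fibers (f := fun i : 'I_t => kfib K (2 * i))).
  apply/allP=> i _; rewrite mem_enum inE; apply/asboolP; by exists (2 * i)%N.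
move=> y _; apply: (@size_le_roots _ L (fun i : 'I_t => g ^+ i) _ [:: -1; - ((a - b) * iota y); 1]).
- by rewrite filter_uniq // enum_uniq.
- by move=> i j _ _; apply: pow_inj.
- by rewrite -size_poly_gt0 (@PolyK _ 0) //= oner_neq0.
move=> i; rewrite mem_filter => /andP[/eqP <- _].
rewrite horner_Poly /= binet_even.
by field; rewrite expf_neq0.
Qed.

(** Zero is set apart because it may have of the order of t representations,
    more than the other values. *)
Lemma count_pairs (Phi : 'I_t * 'I_t -> 'F_p) (S : {set 'F_p}) (Q : nat) :
  (forall r, Phi r \in S) ->
  (size [seq r <- enum {: 'I_t * 'I_t} | Phi r == 0%R] <= 4 * t)%N ->
  (forall y, y != 0 -> (size [seq r <- enum {: 'I_t * 'I_t} | Phi r == y] <= Q)%N) ->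
  (t * t <= 4 * t + #|S| * Q)%N.
Proof.
move=> PS P0 PQ.
have -> : (t * t = size (enum {: 'I_t * 'I_t}))%N by rewrite -cardE card_prod !card_ord.
rewrite -(count_predC (fun r => Phi r == 0)) -!size_filter leq_add // cardE.
apply: (size_le_fibers (f := Phi)).
  by apply/allP=> r _; rewrite mem_enum.
move=> y _; have [->|y0] := eqVneq y 0.
  rewrite -filter_predI (eq_filter (a2 := pred0)) ?filter_pred0 // => r /=.
  by case: eqP.
apply: leq_trans (PQ y y0).
by rewrite -filter_predI !size_filter; apply: sub_count => x /andP[].
Qed.

Variables (T n : nat).
Hypothesis TE : T = (2 * t)%N.
Hypothesis Tp : (T ^ 4 < p ^ 3)%N.
Hypothesis nT : (n ^ 3 <= T < n.+1 ^ 3)%N.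

Let gT i : (g ^+ i) ^+ T = 1.
Proof.
have gt : g ^+ t = 1 := prim_expr_order prim.
by rewrite exprAC TE mulnC exprM gt !expr1n.
Qed.

(** The form of [curve_subgroup_bound] used for counting representations: the
    pairs of exponents are mapped to the u-coordinate with fibers of size at
    most four. *)
Lemma size_curve_pairs (c eps : L) (u v : 'I_t * 'I_t -> L) (l : seq ('I_t * 'I_t)) :
  c != 0 -> eps ^+ 2 = 1 ->
  (forall r, r \in l -> [/\ u r ^+ T = 1, v r ^+ T = 1 &
      (u r - (u r)^-1) * (v r - eps / v r) = c]) ->
  (forall x, x \in map u l -> (size [seq r <- l | u r == x] <= 4)%N) ->
  (size l <= 388 * n ^ 2 * 4)%N.
Proof.
move=> c0 eps2 lP l4.
apply: (@leq_trans (size (undup (map u l)) * 4)).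
  apply: (size_le_fibers (f := u)).
    by apply/allP=> r rl; rewrite mem_undup map_f.
  by move=> x; rewrite mem_undup; apply: l4.
rewrite leq_mul2r; apply/orP; right.
have pL : p \in [pchar L] by rewrite (fmorph_pchar iota) pchar_Fp.
apply: (curve_subgroup_bound pL c0 eps2 _ _ Tp nT) => //.
- by rewrite TE oddM.
- by rewrite TE muln_gt0.
- exact: undup_uniq.
move=> x; rewrite mem_undup => /mapP[r rl ->].
by have [h1 h2 h3] := lP r rl; split=> //; exists (v r).
Qed.

Let Phi2 (r : 'I_t * 'I_t) := kfib K (2 * r.1) * kfib K (2 * r.2).
Let Phi1 (r : 'I_t * 'I_t) := kfib K (2 * (2 * r.1)) + kfib K (2 * (2 * r.2)).

Let pair_fiber_uniq (P : pred ('I_t * 'I_t)) : uniq [seq r <- enum {: 'I_t * 'I_t} | P r].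
Proof. by rewrite filter_uniq // enum_uniq. Qed.

Let gn0 i : g ^+ i != 0. Proof. exact: expf_neq0. Qed.

(** For y <> 0, fixing u = g^i leaves a quadratic equation for g^j.  For y = 0
    one of g^i, g^j has square 1. *)
Lemma prodset_count : (t * t <= 4 * t + #|prodset (kfib_set K)| * (388 * n ^ 2 * 4))%N.
Proof.
apply: (@count_pairs Phi2).
- move=> r; apply/imset2P; exists (kfib K (2 * r.1)) (kfib K (2 * r.2)) => //.
  + by rewrite inE; apply/asboolP; exists (2 * r.1)%N.
  + by rewrite inE; apply/asboolP; exists (2 * r.2)%N.
- rewrite (_ : 4 * t = t * 2 + t * 2)%N; last by lia.
  set l := [seq _ <- _ | _].
  rewrite -(count_predC (fun r : 'I_t * 'I_t => kfib K (2 * r.1) == 0)) -!size_filter.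
  have ul : uniq l by exact: pair_fiber_uniq.
  have F0 i : kfib K (2 * i) = 0 -> g ^+ i * g ^+ i = 1.
    move=> Fi; have := binet_even i; rewrite Fi rmorph0 mulr0 => /eqP.
    rewrite eq_sym subr_eq0 => /eqP e; rewrite {2}e divff //.
  have pX : Poly [:: -1; 0; 1 : L] != 0.
    by rewrite -size_poly_gt0 (@PolyK _ 0) //= oner_neq0.
  apply: leq_add; rewrite -[X in (_ <= X * 2)%N]size_enum_ord.
    apply: (size_le_fibers (f := snd)); first by apply/allP=> r _; rewrite mem_enum.
    move=> j _; apply: (@size_le_roots _ L (fun r : 'I_t * 'I_t => g ^+ r.1) _ [:: -1; 0; 1]) => //.
    + by do 2!apply: filter_uniq.
    + move=> [i1 j1] [i2 j2]; rewrite !mem_filter /= => /andP[/eqP -> _] /andP[/eqP -> _].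
      by move/pow_inj ->.
    move=> r; rewrite !mem_filter => /and3P[_ /eqP /F0 e _].
    by rewrite horner_Poly /= -[RHS](subrr 1) -{2}e; ring.
  apply: (size_le_fibers (f := fst)); first by apply/allP=> r _; rewrite mem_enum.
  move=> j _; apply: (@size_le_roots _ L (fun r : 'I_t * 'I_t => g ^+ r.2) _ [:: -1; 0; 1]) => //.
  + by do 2!apply: filter_uniq.
  + move=> [i1 j1] [i2 j2]; rewrite !mem_filter /= => /andP[/eqP -> _] /andP[/eqP -> _].
    by move/pow_inj ->.
  move=> r; rewrite !mem_filter => /and4P[_ F1 /eqP F2 _].
  move/eqP: F2; rewrite /Phi2 mulf_eq0 => /orP[F1'|/eqP /F0 e]; first by case/negP: F1.
  by rewrite horner_Poly /= -[RHS](subrr 1) -{2}e; ring.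
move=> y y0; set l := [seq _ <- _ | _].
pose c := (a - b) ^+ 2 * iota y.
have c0 : c != 0 by rewrite mulf_neq0 ?expf_neq0 // fmorph_eq0.
have lE r : r \in l -> (g ^+ r.1 - (g ^+ r.1)^-1) * (g ^+ r.2 - (g ^+ r.2)^-1) = c.
  rewrite mem_filter => /andP[/eqP e _].
  by rewrite -!binet_even /c -e /Phi2 rmorphM; ring.
apply: (@size_curve_pairs c 1 (fun r => g ^+ r.1) (fun r => g ^+ r.2)) => //.
- by rewrite expr1n.
- by move=> r rl; rewrite !gT mul1r lE.
move=> x /mapP[[i0 j0] rl ->] /=.
apply: (@leq_trans 2) => //.
pose h := g ^+ i0 - (g ^+ i0)^-1.
apply: (@size_le_roots _ L (fun r : 'I_t * 'I_t => g ^+ r.2) _ [:: - h; - c; h]).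
- by rewrite filter_uniq // pair_fiber_uniq.
- move=> [i1 j1] [i2 j2]; rewrite !mem_filter /= => /andP[/eqP /pow_inj -> _] /andP[/eqP /pow_inj -> _].
  by move/pow_inj ->.
- apply/eqP=> /(congr1 (fun q : {poly L} => q`_1)) /eqP.
  by rewrite coef_Poly /= coef0 oppr_eq0 (negPf c0).
move=> r; rewrite mem_filter => /andP[/eqP ri /lE]; rewrite ri -/h => e.
rewrite horner_Poly /= -e; field; exact: gn0.
Qed.

(** With h = g^i, k = g^j, u = h k and v = h / k,
      h^2 - h^(-2) + k^2 - k^(-2) = (u - 1/u) (v + 1/v),
    which is why the indices 4i are used.  Given u, substituting k = u / h
    leaves an equation of degree 4 for h. *)
Lemma sumset_count : (t * t <= 4 * t + #|sumset (kfib_set K)| * (388 * n ^ 2 * 4))%N.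
Proof.
apply: (@count_pairs Phi1).
- move=> r; apply/imset2P; exists (kfib K (2 * (2 * r.1))) (kfib K (2 * (2 * r.2))) => //.
  + by rewrite inE; apply/asboolP; exists (2 * (2 * r.1))%N.
  + by rewrite inE; apply/asboolP; exists (2 * (2 * r.2))%N.
- rewrite [X in (_ <= X)%N]mulnC -[X in (_ <= X * 4)%N]size_enum_ord.
  apply: (size_le_fibers (f := snd)); first by apply/allP=> r _; rewrite mem_enum.
  move=> j _.
  pose h := (a - b) * iota (kfib K (2 * (2 * j))).
  apply: (@size_le_roots _ L (fun r : 'I_t * 'I_t => g ^+ r.1) _ [:: -1; 0; h; 0; 1]).
  + by rewrite filter_uniq // pair_fiber_uniq.
  + move=> [i1 j1] [i2 j2]; rewrite !mem_filter /= => /andP[/eqP -> _] /andP[/eqP -> _].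
    by move/pow_inj ->.
  + by rewrite -size_poly_gt0 (@PolyK _ 0) //= oner_neq0.
  move=> r; rewrite !mem_filter => /and3P[/eqP rj /eqP e _].
  have := congr1 (fun y => (a - b) * iota y) e.
  rewrite /Phi1 rmorphD rmorph0 mulr0 rj mulrDr -/h binet_even mulnC exprM => {}e.
  rewrite horner_Poly /= (_ : h = - (g ^+ r.1 ^+ 2 - (g ^+ r.1 ^+ 2)^-1)); last first.
    by apply/eqP; rewrite -addr_eq0 addrC e.
  by field; exact: gn0.
move=> y y0; set l := [seq _ <- _ | _].
pose c := (a - b) * iota y.
have c0 : c != 0 by rewrite mulf_neq0 // fmorph_eq0.
have lE r : r \in l ->
    (g ^+ r.1) ^+ 2 - ((g ^+ r.1) ^+ 2)^-1 + ((g ^+ r.2) ^+ 2 - ((g ^+ r.2) ^+ 2)^-1) = c.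
  rewrite mem_filter => /andP[/eqP e _].
  by rewrite -![(g ^+ _) ^+ 2]exprM ![(_ * 2)%N]mulnC -!binet_even /c -e /Phi1 rmorphD mulrDr.
apply: (@size_curve_pairs c (-1) (fun r => g ^+ r.1 * g ^+ r.2) (fun r => g ^+ r.1 / g ^+ r.2)) => //.
- by rewrite sqrrN expr1n.
- move=> r rl; rewrite exprMn expr_div_n !gT divr1 mulr1; split=> //.
  by rewrite -(lE r rl); field; rewrite !gn0.
move=> x /mapP[r0 rl xE].
have x0 : x != 0 by rewrite xE mulf_neq0.
apply: (@size_le_roots _ L (fun r : 'I_t * 'I_t => g ^+ r.1) _
  [:: x ^+ 2 - 1; 0; - c; 0; 1 - (x ^+ 2)^-1]).
- by rewrite filter_uniq // pair_fiber_uniq.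
- move=> [i1 j1] [i2 j2]; rewrite !mem_filter /= => /andP[/eqP e1 _] /andP[/eqP e2 _].
  move/pow_inj=> i12; move: e1; rewrite i12 -e2 => /(mulfI (gn0 _)) /pow_inj -> //.
- apply/eqP=> /(congr1 (fun q : {poly L} => q`_2)) /eqP.
  by rewrite coef_Poly /= coef0 oppr_eq0 (negPf c0).
move=> r; rewrite mem_filter => /andP[/eqP ri /lE e].
rewrite horner_Poly /= -e -ri; field; rewrite !gn0 //.
Qed.

End Counting.

(** * Growth of the sum set and the product set *)

(** Up to constants, t^2 <= S n^2 with n^3 <= 2t gives t^4 <= S^3.  The value
    t = 8 is where the term 4 t drops to half of t^2. *)
Lemma growth_arith (t n S a d : nat) :
  (t * t <= 4 * t + S * (d * n ^ 2 * 4))%N -> (n ^ 3 <= 2 * t)%N ->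
  (a <= 2 * t)%N -> (0 < S)%N -> (1 < d)%N -> (a ^ 4 <= (32 * d * S) ^ 3)%N.
Proof.
move=> tS nt at2 S0 d1; have [t8|t8] := ltnP t 8.
  apply: (@leq_trans (16 ^ 4)); first by rewrite leq_exp2r //; lia.
  apply: (@leq_trans (64 ^ 3)).
    by rewrite -[16%N]/(2 ^ 4)%N -[64%N]/(2 ^ 6)%N -!expnM leq_exp2l.
  rewrite leq_exp2r //; nia.
have tS' : (t * t <= 8 * d * S * n ^ 2)%N by nia.
have t0 : (0 < t)%N by apply: leq_trans t8.
have t6 : ((t * t) ^ 3 <= (8 * d * S) ^ 3 * (2 * t) ^ 2)%N.
  apply: (@leq_trans ((8 * d * S * n ^ 2) ^ 3)); first by rewrite leq_exp2r.
  by rewrite [X in (X <= _)%N]expnMn leq_mul2l -expnM (mulnC 2 3) expnM leq_exp2r // nt orbT.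
have t4 : (t ^ 4 <= (8 * d * S) ^ 3 * 4)%N.
  rewrite -(@leq_pmul2r (t ^ 2)) ?expn_gt0 ?t0 //.
  rewrite (_ : t ^ 4 * t ^ 2 = (t * t) ^ 3)%N; last by ring.
  by apply: (leq_trans t6); rewrite (expnMn 2 t 2) mulnA leqnn.
apply: (@leq_trans ((2 * t) ^ 4)); first by rewrite leq_exp2r.
rewrite expnMn (_ : (32 * d * S) ^ 3 = 2 ^ 4 * (4 * (8 * d * S) ^ 3))%N; last by ring.
by rewrite leq_mul2l mulnC t4.
Qed.

Lemma ex_cube_root (T : nat) : exists n, (n ^ 3 <= T < n.+1 ^ 3)%N.
Proof.
have ex : exists n, (n ^ 3 <= T)%N by exists 0%N.
have bd n : (n ^ 3 <= T)%N -> (n <= T)%N.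
  by apply: leq_trans; case: n => // n; rewrite -{1}[n.+1]expn1 leq_pexp2l.
case: (ex_maxnP ex bd) => n nT nmax; exists n; rewrite nT /= ltnNge.
by apply/negP => /nmax; rewrite ltnn.
Qed.

(** The hypothesis gives the condition T^4 < p^3 of [curve_subgroup_bound] for
    T = 2t, because T <= 4 #|kfib_set K|. *)
Lemma kfib_growth (p : nat) (K : 'F_p) :
  prime p -> ((6 * #|kfib_set K|) ^ 4 < p ^ 3)%N ->
  (#|kfib_set K| ^ 4 <= (32 * 388 * #|sumset (kfib_set K)|) ^ 3)%N /\
  (#|kfib_set K| ^ 4 <= (32 * 388 * #|prodset (kfib_set K)|) ^ 3)%N.
Proof.
move=> pp ap; have [L [iota [a [b [abK ab1 [m m0 am]]]]]] := fib_roots K.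
have A0 : (0 : 'F_p) \in kfib_set K by rewrite inE; apply/asboolP; exists 0%N.
have a_gt0 : (0 < #|kfib_set K|)%N by apply/card_gt0P; exists 0.
have p2 : (2 < p)%N.
  rewrite ltnNge; apply/negP => p2; move: ap; apply/negP; rewrite -leqNgt.
  apply: (@leq_trans (2 ^ 4)); first by apply: (@leq_trans (2 ^ 3)); rewrite ?leq_exp2r ?leq_exp2l.
  by rewrite leq_exp2r //; lia.
have aNb : a - b != 0.
  rewrite subr_eq0; apply/eqP=> ab; rewrite -ab in abK ab1.
  move: ap; rewrite (kfib_set_full pp p2 abK ab1); apply/negP; rewrite -leqNgt.
  apply: (@leq_trans ((6 * p) ^ 3)); first by rewrite leq_exp2r // leq_pmull.
  by rewrite leq_pexp2l // muln_gt0 (prime_gt0 pp).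
have [t prim _] : {t | t.-primitive_root (a ^+ 2) & (t %| m)%N}.
  by apply: prim_order_exists => //; rewrite exprAC am expr1n.
have [n nT] := ex_cube_root (2 * t).
have at2 := card_kfib_set_le abK ab1 aNb prim.
have t2a := order_le abK ab1 prim.
have Tp : ((2 * t) ^ 4 < p ^ 3)%N.
  by apply: leq_ltn_trans ap; rewrite leq_exp2r //; lia.
have n3 : (n ^ 3 <= 2 * t)%N by case/andP: nT.
split; apply: (growth_arith _ n3 at2) => //.
- exact: (sumset_count pp abK ab1 aNb prim (erefl _) Tp nT).
- by apply/card_gt0P; exists (0 + 0); apply/imset2P; exists 0 0.
- exact: (prodset_count pp abK ab1 aNb prim (erefl _) Tp nT).
- by apply/card_gt0P; exists (0 * 0); apply/imset2P; exists 0 0.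
Qed.

Lemma powR_lt_of_pow (R : realType) (a s d : nat) :
  (0 < a)%N -> (0 < d)%N -> (a ^ 4 <= (d * s) ^ 3)%N ->
  ((d.+1)%:R)^-1 * (a%:R `^ (4 / 3)) < s%:R :> R.
Proof.
move=> a0 d0 h.
have s0 : (0 < s)%N.
  rewrite lt0n; apply/eqP => s0; move: h; rewrite s0 muln0 leqn0 expn_eq0 eqn0Ngt a0 //.
have h' : a%:R `^ (4 / 3) <= (d * s)%:R :> R.
  rewrite (_ : (d * s)%:R = ((d * s) ^ 3)%:R `^ (3^-1)); last first.
    by rewrite natrX -powR_mulrn ?ler0n // -powRrM mulfV ?pnatr_eq0 // powRr1 ?ler0n.
  rewrite powRrM powR_mulrn // -natrX ge0_ler_powR // ?invr_ge0 ?nnegrE ?ler0n //.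
  by rewrite ler_nat.
apply: (@le_lt_trans _ _ (d.+1%:R^-1 * (d * s)%:R)).
  by rewrite ler_pM2l // invr_gt0 ltr0n.
by rewrite ltr_pdivrMl ?ltr0n // -natrM ltr_nat ltn_pmul2r.
Qed.

Theorem theorem1 (R : realType) :
  exists C : R, 0 < C /\
    forall (p : nat) (K : 'F_p), prime p -> K != 0 ->
      #|kfib_set K|%:R < 1 / 6 * (p%:R `^ (3 / 4)) :> R ->
      #|sumset (kfib_set K)|%:R > C * (#|kfib_set K|%:R `^ (4 / 3)) /\
      #|prodset (kfib_set K)|%:R > C * (#|kfib_set K|%:R `^ (4 / 3)).
Proof.
(* Any constant larger than 32 * 388, the one of [kfib_growth], makes the
   inequalities strict. *)
exists ((32 * 388).+1%:R^-1); split; first by rewrite invr_gt0 ltr0n.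
move=> p K pp _ hA.
have a_gt0 : (0 < #|kfib_set K|)%N.
  by apply/card_gt0P; exists 0; rewrite inE; apply/asboolP; exists 0%N.
have ap : ((6 * #|kfib_set K|) ^ 4 < p ^ 3)%N.
  rewrite -(ltr_nat R) !natrX natrM.
  have h6 : 6%:R * #|kfib_set K|%:R < p%:R `^ (3 / 4) :> R by lra.
  have -> : p%:R ^+ 3 = (p%:R `^ (3 / 4)) ^+ 4 :> R.
    by rewrite -[RHS]powR_mulrn ?powR_ge0 // -powRrM divfK ?pnatr_eq0 // powR_mulrn.
  by rewrite ltrXn2r // mulr_ge0.
have [hs hp] := kfib_growth pp ap.
by split; apply: powR_lt_of_pow.
Qed.
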